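(* In the Demon Money game, for every integer $k>0$: every pile size $N$ with $k^2+k-1\le N\le (k+1)^2-2$ is an N-position, and every pile size $N$ with $k^2-1\le N\le k^2+k-2$ is a P-position.
   Context: Demon Money game: a position is a pile of $N\ge 0$ coins. Two players alternate moves. From a pile of $N>0$ coins, the player to move removes either $\lfloor\sqrt N\rfloor$ or $\lceil\sqrt N\rceil$ coins (if $N=k^2$ is a perfect square, the only move is to remove $k$ coins). There is no move from the empty pile $N=0$, and the player who faces it loses (so $0$ is a P-position). A P-position is a position from which the previous player (the one not about to move) wins under perfect play; an N-position is a position from which the next player (the one about to move) wins under perfect play. *)

(* Defs.v *)
From Stdlib Require Import Arith List Sorted.

(* [Nat.sqrt] and [Nat.sqrt_up] are the floor and the ceiling of the real square
   root.  They agree on perfect squares, which then have a single move. *)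
Definition demon_move (N M : nat) : Prop :=
  0 < N /\ (M + Nat.sqrt N = N \/ M + Nat.sqrt_up N = N).

(* [Next] is the player about to move in the starting position. *)
Inductive player : Set := Next | Previous.

Definition to_move (i : nat) : player := if Nat.even i then Next else Previous.

(* A strategy [s] maps the list [h] of earlier positions (oldest first) and the
   current position [M] to the position moved to.  Legality is required after
   every history, which is harmless: a strategy may be changed freely on
   histories that never arise. *)
Definition strategy : Type := list nat -> nat -> nat.

Definition legal (s : strategy) : Prop :=
  forall (h : list nat) (M : nat), 0 < M -> demon_move M (s h M).

(* [Sorted] only relates adjacent entries: [N :: p] is the list of successive
   positions. *)
Definition play (N : nat) (p : list nat) : Prop := Sorted demon_move (N :: p).

Definition follows (w : player) (s : strategy) (N : nat) (p : list nat) : Prop :=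
  forall (h : list nat) (M M' : nat) (t : list nat),
    N :: p = h ++ M :: M' :: t -> to_move (length h) = w -> M' = s h M.

(* Every move removes a coin, so every play can be continued to one ending at the
   empty pile, and there are no infinite plays to consider.  The player facing
   the empty pile is [to_move (length p)]. *)
Definition winning (w : player) (s : strategy) (N : nat) : Prop :=
  forall p : list nat,
    play N p -> follows w s N p -> last p N = 0 -> to_move (length p) <> w.

Definition wins (w : player) (N : nat) : Prop :=
  exists s : strategy, legal s /\ winning w s N.

Definition P_position (N : nat) : Prop := wins Previous N.

Definition N_position (N : nat) : Prop := wins Next N.

(* Main.v *)
Require Import Defs.
From Stdlib Require Import Arith.
From Stdlib Require Import List Sorted Lia.
Import ListNotations.

(** Cut the pile sizes into blocks [k^2 - 1 <= N < (k+1)^2 - 1], one for each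
    [k > 0], and call the lower part [N <= k^2 + k - 2] of each block cold and
    the upper part hot.  Cold and hot sizes behave as the P- and N-positions of a
    game must:
    - a move from a cold size of block [k] removes [k - 1], [k] or [k + 1] coins
      and always lands among the hot sizes of block [k - 1] ([cold_move_hot]);
    - from a hot size of block [k], removing [k] coins (from the smallest one) or
      [k + 1] coins (from any other) lands among the cold sizes of the same block
      ([keep_cold_hot]);
    - the empty pile is cold.
    So the player who once leaves a cold pile can do so forever, hence always
    faces hot piles and never the empty one.  The strategy reads only the current
    pile; that is what makes induction along a play possible, since forgetting
    the first position of a play leaves a play that follows the same strategy,
    with the roles of the two players exchanged ([follows_tail]). *)

(** * Cold and hot pile sizes *)

(** The block of [N] has index [k = sqrt (N + 1)], because blocks start at
    [k^2 - 1]. *)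
Definition cold (N : nat) : bool :=
  let k := Nat.sqrt (N + 1) in N + 2 <=? k * k + k.

Lemma cold_in_block (k N : nat) :
  k * k <= N + 1 < (k + 1) * (k + 1) -> cold N = (N + 2 <=? k * k + k).
Proof.
  intros H. unfold cold.
  rewrite (Nat.sqrt_unique (N + 1) k) by lia. reflexivity.
Qed.

Lemma block_exists (N : nat) :
  exists k, 0 < k /\ k * k <= N + 1 < (k + 1) * (k + 1).
Proof.
  exists (Nat.sqrt (N + 1)).
  pose proof (Nat.sqrt_spec' (N + 1)) as H. cbv zeta in H.
  destruct (Nat.sqrt (N + 1)); lia.
Qed.

(** The floor of the square root within a block: the first size [k^2 - 1] lies
    just below a square and is the one exception. *)
Lemma sqrt_in_block (k N : nat) :
  0 < k -> k * k <= N + 1 < (k + 1) * (k + 1) ->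
  Nat.sqrt N = if N + 1 =? k * k then k - 1 else k.
Proof.
  intros Hk H. apply Nat.sqrt_unique.
  destruct (Nat.eqb_spec (N + 1) (k * k)) as [E | E]; [| lia].
  destruct k as [| k]; [lia |].
  replace (S k - 1) with k by lia. nia.
Qed.

Lemma sqrt_up_in_block (k N : nat) :
  0 < k -> k * k <= N + 1 < (k + 1) * (k + 1) ->
  Nat.sqrt_up N = if N <=? k * k then (if N =? 0 then 0 else k) else k + 1.
Proof.
  intros Hk H.
  destruct (Nat.eqb_spec N 0) as [-> | HN].
  { destruct (Nat.leb_spec 0 (k * k)); [reflexivity | lia]. }
  destruct (Nat.leb_spec N (k * k)) as [L | L]; apply Nat.sqrt_up_unique.
  - lia.
  - destruct k as [| k]; [lia |]. simpl Nat.pred. nia.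
  - lia.
  - rewrite Nat.add_1_r. simpl Nat.pred. nia.
Qed.

Lemma cold_move_hot (N M : nat) :
  demon_move N M -> cold N = true -> cold M = false.
Proof.
  intros [HN Hmove] Hcold.
  destruct (block_exists N) as [k [Hk HB]].
  rewrite (cold_in_block k N HB) in Hcold.
  apply Nat.leb_le in Hcold.
  rewrite (sqrt_in_block k N Hk HB), (sqrt_up_in_block k N Hk HB) in Hmove.
  (* The first block has only the empty pile as a cold size, so [k >= 2]. *)
  destruct k as [| [| j]]; [lia | simpl in Hcold; lia |].
  set (k := S (S j)) in *.
  assert (HM : k * k <= M + k + 1 /\ M + 2 <= k * k).
  { destruct (Nat.eqb_spec (N + 1) (k * k)), (Nat.leb_spec N (k * k)),
      (Nat.eqb_spec N 0); lia. }
  rewrite (cold_in_block (S j) M) by (subst k; nia).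
  apply Nat.leb_gt. subst k; nia.
Qed.

(** * The strategy *)

(** One rule serves both players: from a hot pile it reaches a cold one, and from
    a cold pile no choice matters, so any legal move will do. *)
Definition keep_cold : strategy := fun _ M =>
  let M' := M - Nat.sqrt M in
  if cold M' then M' else M - Nat.sqrt_up M.

Lemma keep_cold_legal : legal keep_cold.
Proof.
  intros h M HM. split; [exact HM |]. unfold keep_cold.
  pose proof (Nat.sqrt_le_lin M). pose proof (Nat.sqrt_up_le_lin M).
  destruct (cold (M - Nat.sqrt M)); lia.
Qed.

Lemma keep_cold_hot (h : list nat) (N : nat) :
  cold N = false -> cold (keep_cold h N) = true.
Proof.
  intros Hhot. unfold keep_cold.
  destruct (cold (N - Nat.sqrt N)) eqn:Hfloor; [exact Hfloor |].
  destruct (block_exists N) as [k [Hk HB]].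
  rewrite (cold_in_block k N HB) in Hhot.
  apply Nat.leb_gt in Hhot.
  rewrite (sqrt_in_block k N Hk HB) in Hfloor.
  destruct (Nat.eqb_spec (N + 1) (k * k)) as [E | E]; [lia |].
  destruct (Nat.eq_dec (N + 1) (k * k + k)) as [Ek | Ek].
  - (* The smallest hot size: removing the floor does reach a cold size. *)
    rewrite (cold_in_block k (N - k)) in Hfloor by nia.
    apply Nat.leb_gt in Hfloor. lia.
  - rewrite (sqrt_up_in_block k N Hk HB).
    destruct (Nat.leb_spec N (k * k)); [lia |].
    rewrite (cold_in_block k) by nia.
    apply Nat.leb_le. lia.
Qed.

(** * Plays *)

Definition opponent (w : player) : player :=
  match w with Next => Previous | Previous => Next end.

Lemma opponent_involutive (w : player) : opponent (opponent w) = w.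
Proof. destruct w; reflexivity. Qed.

Lemma to_move_succ (n : nat) : to_move (S n) = opponent (to_move n).
Proof.
  unfold to_move. rewrite Nat.even_succ, <- Nat.negb_even.
  destruct (Nat.even n); reflexivity.
Qed.

(** Holds because [keep_cold] ignores the history, which loses its oldest entry
    when the play loses its first position. *)
Lemma follows_tail (w : player) (N M : nat) (p : list nat) :
  follows w keep_cold N (M :: p) -> follows (opponent w) keep_cold M p.
Proof.
  intros Hf h K K' t Hsplit Hturn.
  apply (Hf (N :: h) K K' t).
  - simpl. now rewrite <- Hsplit.
  - simpl length. now rewrite to_move_succ, Hturn, opponent_involutive.
Qed.

Lemma last_cons (A : Type) (x d : A) (l : list A) : last (x :: l) d = last l x.
Proof.
  revert x d. induction l as [| y l IH]; intros x d; [reflexivity |].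
  transitivity (last (y :: l) d); [reflexivity |].
  now rewrite !IH.
Qed.

Definition winner (N : nat) : player := if cold N then Previous else Next.

(** A mover at a cold pile cannot avoid a hot one, and a mover at a hot pile is the
    one using the strategy, so the pile changes temperature either way. The same
    person stays the winner: after a move each player goes by the other name. *)
Lemma winner_step (N M : nat) (p : list nat) :
  demon_move N M -> follows (winner N) keep_cold N (M :: p) ->
  winner M = opponent (winner N).
Proof.
  unfold winner. intros Hmove Hf.
  destruct (cold N) eqn:HN.
  - now rewrite (cold_move_hot N M Hmove HN).
  - rewrite (Hf [] N M p eq_refl eq_refl).
    now rewrite keep_cold_hot.
Qed.

Lemma keep_cold_winning (N : nat) : winning (winner N) keep_cold N.
Proof.
  intros p. revert N.
  induction p as [| M p IH]; intros N Hplay Hf Hlast.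
  - simpl in Hlast. subst N. discriminate.
  - apply Sorted_inv in Hplay as [Htail Hmove].
    apply HdRel_inv in Hmove.
    pose proof (winner_step N M p Hmove Hf) as Hw.
    rewrite last_cons in Hlast.
    simpl length. rewrite to_move_succ. intros Hloses.
    apply (IH M Htail); [| exact Hlast |].
    + rewrite Hw. exact (follows_tail _ _ _ _ Hf).
    + now rewrite Hw, <- Hloses, opponent_involutive.
Qed.

Lemma winner_wins (N : nat) : wins (winner N) N.
Proof.
  exists keep_cold. split; [exact keep_cold_legal | apply keep_cold_winning].
Qed.

Theorem theorem6 : forall k : nat, 0 < k ->
  (forall N : nat, k ^ 2 + k - 1 <= N <= (k + 1) ^ 2 - 2 -> N_position N) /\
  (forall N : nat, k ^ 2 - 1 <= N <= k ^ 2 + k - 2 -> P_position N).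
Proof.
  intros k Hk.
  split; intros N HN; rewrite !Nat.pow_2_r in HN;
    pose proof (winner_wins N) as W; unfold winner in W;
    rewrite (cold_in_block k N) in W by nia.
  - destruct (Nat.leb_spec (N + 2) (k * k + k)); [nia | exact W].
  - destruct (Nat.leb_spec (N + 2) (k * k + k)); [exact W | nia].
Qed.
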